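(* Let $s>0$ and let $(\mathcal{X},d_{\mathcal{X}})$ be an Ahlfors $s$-regular compact metric space with more than one point, with a priori measure $\rho$, that is, a Borel probability measure $\rho$ on $\mathcal{X}$ for which there is a constant $c\ge 1$ with $c^{-1}r^s\le \rho(\overline{B}(x,r))\le c r^s$ for all $x\in\mathcal{X}$ and $0<r\le \operatorname{diam}\mathcal{X}$. Equip $\mathcal{X}^{\mathbb{N}_0}$ with the metric $d(\underline{x},\underline{y})=\sum_{n\in\mathbb{N}_0}2^{-n}d_{\mathcal{X}}(x_n,y_n)$ and let $\sigma$ be the left shift. Let $\varphi:\mathcal{X}^{\mathbb{N}_0}\to\mathbb{R}$ be a Hölder continuous function depending on the first two coordinates, and let $\mu_\varphi$ be the Gibbs measure of $\varphi$ with respect to $\rho$. Then $$\mathrm{rdim}(\mathcal{X}^{\mathbb{N}_0},\sigma,d,\mu_\varphi)=s,$$ i.e. the upper and lower rate distortion dimensions of $\mu_\varphi$ coincide and are equal to $s$.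
   Context: $\mathbb{N}_0=\{0,1,2,\dots\}$; $\overline{B}(x,r)$ is the closed ball; $\sigma((x_n)_{n\ge0})=(x_{n+1})_{n\ge0}$. Depending on the first two coordinates: $\varphi(\underline{x})=\varphi(\underline{y})$ whenever $x_0=y_0$ and $x_1=y_1$; one then writes $\varphi(x_0,x_1)$. Hölder continuity is with respect to $d$. Gibbs measure: define $\mathcal{L},\overline{\mathcal{L}}:C(\mathcal{X})\to C(\mathcal{X})$ by $\mathcal{L}\psi(x_1)=\int e^{\varphi(x_0,x_1)}\psi(x_0)\,d\rho(x_0)$ and $\overline{\mathcal{L}}\psi(x_0)=\int e^{\varphi(x_0,x_1)}\psi(x_1)\,d\rho(x_1)$. It is known that $\mathcal{L}$ and $\overline{\mathcal{L}}$ have the same positive maximal eigenvalue $\lambda$, which is simple and isolated, with positive eigenfunctions. Let $\psi,\overline{\psi}>0$ be the eigenfunctions of $\mathcal{L},\overline{\mathcal{L}}$ for $\lambda$ normalized by $\int\psi\,d\rho=\int\overline{\psi}\,d\rho=1$. Put $\pi=\int\psi\overline{\psi}\,d\rho$, $\theta(x)=\psi(x)\overline{\psi}(x)/\pi$ and $K(x_0,x_1)=\dfrac{e^{\varphi(x_0,x_1)}\overline{\psi}(x_1)}{\overline{\psi}(x_0)\lambda}$. The Gibbs measure $\mu_\varphi$ is the $\sigma$-invariant Borel probability measure on $\mathcal{X}^{\mathbb{N}_0}$ which is the law of the stationary Markov process with initial density $\theta$ and transition density $K$ (both with respect to $\rho$), i.e. $\mu_\varphi(A_0\times\cdots\times A_n\times\mathcal{X}^{\mathbb{N}_0})=\int_{A_0\times\cdots\times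 A_n}\theta(x_0)K(x_0,x_1)\cdots K(x_{n-1},x_n)\,d\rho(x_0)\cdots d\rho(x_n)$ for Borel sets $A_i\subset\mathcal{X}$. Mutual information: for random variables $X,Y$ on a common probability space $(\Omega,\mathbb{P})$ with values in measurable spaces, $I(X;Y)$ is the supremum of $\sum_{m,n}\mathbb{P}((X,Y)\in P_m\times Q_n)\log\frac{\mathbb{P}((X,Y)\in P_m\times Q_n)}{\mathbb{P}(X\in P_m)\mathbb{P}(Y\in Q_n)}$ over finite measurable partitions $\{P_m\},\{Q_n\}$ of the two target spaces (with $0\log(0/a)=0$ for all $a\ge 0$). Rate distortion dimension: let $T:\mathcal{Y}\to\mathcal{Y}$ be a continuous map on a compact metric space $(\mathcal{Y},d)$ and $\mu$ a $T$-invariant Borel probability measure. For $\varepsilon>0$, $R(d,\mu,\varepsilon)$ is the infimum of $I(X;Y)/n$ over all $n\in\mathbb{N}$ and all random variables $X$ and $Y=(Y_0,\dots,Y_{n-1})$ on some common probability space such that $X$ takes values in $\mathcal{Y}$ with law $\mu$, each $Y_k$ takes values in $\mathcal{Y}$, and $\mathbb{E}\big(\frac1n\sum_{k=0}^{n-1}d(T^kX,Y_k)\big)<\varepsilon$. Then $\overline{\mathrm{rdim}}(\mathcal{Y},T,d,\mu)=\limsup_{\varepsilon\to0}R(d,\mu,\varepsilon)/|\log\varepsilon|$ and $\underline{\mathrm{rdim}}(\mathcal{Y},T,d,\mu)=\liminf_{\varepsilon\to0}R(d,\mu,\varepsilon)/|\log\varepsilon|$; $\mathrm{rdim}$ denotes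 their common value when they agree. *)

(* Defs.v *)
From HB Require Import structures.
From mathcomp Require Import all_boot all_order all_algebra.
From mathcomp Require Import all_classical all_reals all_analysis.

Set Implicit Arguments.
Unset Strict Implicit.
Unset Printing Implicit Defensive.

Import Order.TTheory GRing.Theory Num.Theory.
Import numFieldNormedType.Exports.

Local Open Scope classical_set_scope.
Local Open Scope ring_scope.

(* A base point is required by the library's measurable types. *)
#[short(type="pmetricType")]
HB.structure Definition PointedMetric (R : numDomainType) :=
  { M of Metric R M & isPointed M }.

HB.mixin Record isCompactSpace M & Topological M := {
  compact_setT : compact [set: M]
}.

#[short(type="compactMetricType")]
HB.structure Definition CompactMetric (R : numDomainType) :=
  { M of PointedMetric R M & isCompactSpace M }.

Definition borel (X : ptopologicalType) := g_sigma_algebraType (@open X).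

Definition diam (R : realType) (X : pmetricType R) : R :=
  sup [set mdist p.1 p.2 | p in [set: X * X]].

(* Not the library's [closed_ball], which is the closure of the open ball. *)
Definition cball (R : realType) (X : pmetricType R) (x : X) (r : R) : set X :=
  [set y | mdist x y <= r].

Definition ahlfors_regular (R : realType) (X : pmetricType R) (s : R)
    (rho : probability (borel X) R) : Prop :=
  exists2 c : R, 1 <= c &
    forall (x : X) (r : R), 0 < r <= diam X ->
      ((c^-1 * r `^ s)%:E <= rho (cball x r) <= (c * r `^ s)%:E)%E.

Definition holder (R : realType) (Y : pmetricType R) (phi : Y -> R) : Prop :=
  exists a C : R, 0 < a <= 1 /\
    forall x y : Y, `|phi x - phi y| <= C * mdist x y `^ a.

Definition seqspace (T : Type) := nat -> T.

Section SeqspaceMetric.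
Context {R : realType} {X : compactMetricType R}.
Implicit Types x y z : seqspace X.

Definition seqdist x y : R :=
  limn (series (fun n => 2 ^- n * mdist (x n) (y n))).

Lemma mdist_bounded : exists2 M : R, 0 <= M & forall a b : X, mdist a b <= M.
Proof.
have cT : compact [set: X] := compact_setT.
move: cT; rewrite compact_cover => /(_ nat setT (fun n => ball (point : X) n%:R)).
case=> [n _|a _|D _ DT].
- have [->|n0] := eqVneq n 0%N.
    suff -> : ball (point : X) (0%:R : R) = set0 by exact: open0.
    apply/seteqP; split => // t; rewrite ballEmdist /=.
    by rewrite ltNge mdist_ge0.
  rewrite openE => t; rewrite /interior ballEmdist /= => tn.
  apply/nbhs_ballP; exists (n%:R - mdist (point : X) t); first by rewrite /= subr_gt0.
  move=> u; rewrite ballEmdist /= ltrBrDl => tu.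
  exact: le_lt_trans (metric_triangle _ t _) tu.
- exists (Num.truncn (mdist (point : X) a)).+1 => //.
  rewrite ballEmdist /=; exact: truncnS_gt.
pose M : R := \sum_(i <- finmap.enum_fset D) i%:R.
have M0 : 0 <= M by apply: sumr_ge0.
have DM i : i \in finmap.enum_fset D -> i%:R <= M.
  move=> iD; rewrite /M (big_rem i) //= lerDl; exact: sumr_ge0.
have pM (a : X) : mdist (point : X) a <= M.
  have [i /= iD] := DT a I; rewrite ballEmdist /= => /ltW/le_trans; apply.
  exact: DM.
exists (M + M); first exact: addr_ge0.
move=> a b; apply: le_trans (metric_triangle _ (point : X) _) _.
by rewrite lerD// metric_sym.
Qed.

Lemma seqdist_cvg x y : cvgn (series (fun n => 2 ^- n * mdist (x n) (y n) : R)).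
Proof.
have [M M0 HM] := mdist_bounded.
apply: (@series_le_cvg _ _ (geometric M 2^-1)) => [n|n|n|].
- by rewrite mulr_ge0 ?mdist_ge0.
- by rewrite /geometric /= mulr_ge0.
- by rewrite /geometric /= mulrC exprVn ler_wpM2r.
apply: is_cvg_geometric_series.
by rewrite ger0_norm // invf_lt1 // ltr1n.
Qed.

Lemma seqdistxx x : seqdist x x = 0.
Proof.
rewrite /seqdist (_ : series _ = fun=> 0) ?lim_cst //.
by apply/funext => n; rewrite /series /= big1 // => i _; rewrite mdistxx mulr0.
Qed.

Lemma seqdist_positivity x y : seqdist x y = 0 -> x = y.
Proof.
move=> xy; apply/funext => n; apply: (@mdist_positivity R).
apply/eqP; rewrite eq_le mdist_ge0 andbT -(pmulr_rle0 _ (_ : 0 < 2 ^- n)) //.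
rewrite -[leRHS]xy.
have t0 k : 0 <= 2 ^- k * mdist (x k) (y k) by rewrite mulr_ge0 ?mdist_ge0.
have nd : nondecreasing_seq (series (fun n => 2 ^- n * mdist (x n) (y n) : R)).
  by apply: nondecreasing_series => k _.
apply: le_trans (nondecreasing_cvgn_le nd (@seqdist_cvg x y) n.+1).
by rewrite /series /= big_nat_recr //= lerDr sumr_ge0.
Qed.

Lemma seqdist_sym x y : seqdist x y = seqdist y x.
Proof.
rewrite /seqdist; congr (limn (series _)).
by apply/funext => n; rewrite metric_sym.
Qed.

Lemma seqdist_triangle y x z : seqdist x z <= seqdist x y + seqdist y z.
Proof.
rewrite /seqdist -lim_seriesD; try exact: seqdist_cvg.
apply: lim_series_le; first exact: seqdist_cvg.
- by apply: is_cvg_seriesD; exact: seqdist_cvg.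
- by move=> n; rewrite /= -mulrDr ler_pM2l // metric_triangle.
Qed.

HB.instance Definition _ := Choice.copy (seqspace X) (nat -> X).
HB.instance Definition _ := isMetric.Build R (seqspace X)
  seqdistxx seqdist_positivity seqdist_sym seqdist_triangle.
HB.instance Definition _ := isPointed.Build (seqspace X) (fun=> point).

End SeqspaceMetric.

Definition left_shift (T : Type) (x : seqspace T) : seqspace T := fun n => x n.+1.

Definition depends_on_two (T V : Type) (phi : seqspace T -> V) : Prop :=
  forall x y : seqspace T, x 0%N = y 0%N -> x 1%N = y 1%N -> phi x = phi y.

Definition restrict_two (T V : Type) (phi : seqspace T -> V) (a b : T) : V :=
  phi (fun n => if n is 0%N then a else b).

Section GibbsMeasure.
Context {R : realType} {X : compactMetricType R}.
Variables (rho : probability (borel X) R) (phi : seqspace X -> R).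

Definition transfer (psi : X -> R) (x1 : X) : R :=
  \int[rho]_x0 (expR (restrict_two phi x0 x1) * psi x0).

Definition transfer_bar (psi : X -> R) (x0 : X) : R :=
  \int[rho]_x1 (expR (restrict_two phi x0 x1) * psi x1).

Definition eigenfunction (L : (X -> R) -> X -> R) (l : R) (f : X -> R) : Prop :=
  [/\ continuous f, exists x, f x != 0 & forall x, L f x = l * f x].

Definition maximal_eigenvalue (L : (X -> R) -> X -> R) (l : R) : Prop :=
  (exists f, eigenfunction L l f) /\
  forall l' f, eigenfunction L l' f -> l' <= l.

Definition gibbs_density (psi psib : X -> R) (x : X) : R :=
  psi x * psib x / \int[rho]_y (psi y * psib y).

Definition gibbs_kernel (l : R) (psib : X -> R) (x0 x1 : X) : R :=
  expR (restrict_two phi x0 x1) * psib x1 / (psib x0 * l).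

(* With x = x_0: the integral of K(x, x_1) K(x_1, x_2) ... K(x_{n-1}, x_n) over
   x_{i+1} in A_i, as an iterated integral. *)
Fixpoint path_mass (K : X -> X -> R) (n : nat) (A : nat -> set X) (x : X) :
    \bar R :=
  if n is m.+1 then
    (\int[rho]_(y in A 0%N)
       ((K x y)%:E * path_mass K m (fun i => A i.+1) y))%E
  else 1%E.

(* The maximal eigenvalue is simple, so the normalized eigenfunctions, and with
   them the cylinder masses, are unique; shift invariance of mu follows from
   the stationarity of the density. *)
Definition gibbs_measure (mu : probability (borel (seqspace X)) R) : Prop :=
  exists (l : R) (psi psib : X -> R),
    [/\ 0 < l /\ maximal_eigenvalue transfer l /\
          maximal_eigenvalue transfer_bar l,
        eigenfunction transfer l psi /\ eigenfunction transfer_bar l psib,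
        forall x, 0 < psi x /\ 0 < psib x,
        \int[rho]_x psi x = 1 /\ \int[rho]_x psib x = 1 &
        forall (n : nat) (A : nat -> set X),
          (forall i, measurable (A i : set (borel X))) ->
          mu [set x : seqspace X | forall i, (i <= n)%N -> A i (x i)] =
          (\int[rho]_(x in A 0%N)
             ((gibbs_density psi psib x)%:E *
              path_mass (gibbs_kernel l psib) n (fun i => A i.+1) x))%E].

End GibbsMeasure.

Section MutualInformation.
Context {R : realType} {d1 d2 d : measure_display} {T1 : measurableType d1}
  {T2 : measurableType d2} {Omega : measurableType d}.

(* The term with p = 0 vanishes, whatever the value of the logarithm. *)
Definition mutual_info (P : probability Omega R)
    (X : {RV P >-> T1}) (Y : {RV P >-> T2}) : \bar R :=
  ereal_sup [set v | exists (m n : nat) (A : 'I_m -> set T1) (B : 'I_n -> set T2),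
    [/\ partition setT A setT /\ (forall i, measurable (A i)),
        partition setT B setT /\ (forall j, measurable (B j)) &
        v = (\sum_(i < m) \sum_(j < n)
          let p := fine (P (X @^-1` A i `&` Y @^-1` B j)) in
          p * ln (p / (fine (P (X @^-1` A i)) * fine (P (Y @^-1` B j)))))%:E]].

End MutualInformation.

Section RateDistortion.
Context {R : realType} {Y : pmetricType R}.
Variables (T : Y -> Y) (mu : probability (borel Y) R).

Definition mean_distortion (n : nat) (x : Y) (z : n.-tuple Y) : R :=
  n%:R^-1 * \sum_(k < n) mdist (iter k T x) (tnth z k).

(* The law of X is compared with mu on Borel sets only: as functions,
   measures have unspecified values on the other sets. *)
Definition rate_distortion (eps : R) : \bar R :=
  ereal_inf [set v | exists (n : nat) (d : measure_display)
      (Omega : measurableType d) (P : probability Omega R)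
      (X : {RV P >-> borel Y}) (Z : {RV P >-> n.-tuple (borel Y)}),
    [/\ (0 < n)%N,
        forall A : set (borel Y), measurable A -> distribution P X A = mu A,
        ('E_P[fun w => mean_distortion (X w) (Z w)] < eps%:E)%E &
        v = ((n%:R^-1)%:E * mutual_info X Z)%E]].

Definition upper_rdim : \bar R :=
  limf_esup (fun eps : R => (rate_distortion eps * (`|ln eps|^-1)%:E)%E) 0^'+.

Definition lower_rdim : \bar R :=
  limf_einf (fun eps : R => (rate_distortion eps * (`|ln eps|^-1)%:E)%E) 0^'+.

End RateDistortion.

(* Main.v *)
(* Upper bound: quantize every coordinate by a maximal delta-separated set, of
   cardinality N = O(delta^-s) by regularity of rho.  The n distorted points need
   n + m coordinates, with m fixed by delta since the weights 2^-n decay, so the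
   mutual information is at most (n + m) ln N; then let n grow.

   Lower bound: the Gibbs cylinder masses are at most C^n times the product of the
   rho-masses.  By ln t <= t - 1, the mutual information dominates the mean of
   ln f(X, Y) for any f > 0 with E f(X, y) <= 1 for all y.  Apply this to
   f = prod_k exp(-d(x_k, y_k) / eps) / (C D eps^s), where
   int exp(-d(x, z) / eps) d rho(x) <= D eps^s by regularity, after discretizing
   at scale eps.  Hence R(eps) = s |ln eps| + O(1). *)

Require Import Defs.
From HB Require Import structures.
From mathcomp Require Import all_boot all_order all_algebra.
From mathcomp Require Import all_classical all_reals all_analysis.
From mathcomp Require Import measurable_realfun ring lra.

Set Implicit Arguments.
Unset Strict Implicit.
Unset Printing Implicit Defensive.

Import Order.TTheory GRing.Theory Num.Theory.
Import numFieldNormedType.Exports.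

Local Open Scope classical_set_scope.
Local Open Scope ring_scope.

(** * Information inequalities for finite joint distributions *)

Lemma ln_le_subr1 (R : realType) (x : R) : 0 < x -> ln x <= x - 1.
Proof.
by move=> x0; rewrite -{1}(subrKC 1 x) le_ln1Dx// ltrBDl subrr.
Qed.

Lemma mulr_ln_div_le (R : realType) (p a : R) :
  0 <= p -> 0 <= a -> p != 0 -> a != 0 -> p * ln (a / p) <= a - p.
Proof.
move=> p0 a0 pn an.
have pp : 0 < p by rewrite lt_def pn.
have ap : 0 < a by rewrite lt_def an.
apply: le_trans (_ : p * (a / p - 1) <= _).
  by rewrite ler_wpM2l// ln_le_subr1// divr_gt0.
by rewrite mulrBr mulrCA divff// !mulr1.
Qed.

Section discrete_information.
Context {R : realType} {I J : finType}.
Variable p : I -> J -> R.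
Hypothesis p_ge0 : forall i j, 0 <= p i j.

Let margl i := \sum_j p i j.
Let margr j := \sum_i p i j.

Definition discrete_info : R :=
  \sum_i \sum_j p i j * ln (p i j / (margl i * margr j)).

Let margl_ge i j : p i j <= margl i.
Proof. by rewrite /margl (bigD1 j)//= lerDl sumr_ge0. Qed.

Let margr_ge i j : p i j <= margr j.
Proof. by rewrite /margr (bigD1 i)//= lerDl sumr_ge0. Qed.

(** Apply [ln t <= t - 1] with [t = f i j * margl i * margr j / p i j]: each difference of terms is
    at most [f i j * margl i * margr j - p i j]. Summing over [i] first, the hypothesis on [f] makes
    the total at most [\sum_j margr j - 1 = 0]. *)
Lemma discrete_info_ge (f : I -> J -> R) :
  (forall i j, 0 < f i j) ->
  (forall j, \sum_i f i j * margl i <= 1) ->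
  \sum_i \sum_j p i j = 1 ->
  \sum_i \sum_j p i j * ln (f i j) <= discrete_info.
Proof.
move=> f0 f1 psum.
rewrite -subr_le0 /discrete_info -sumrB.
under eq_bigr do rewrite -sumrB.
apply: (@le_trans _ _ (\sum_i \sum_j (f i j * margl i * margr j - p i j))).
  apply: ler_sum => i _; apply: ler_sum => j _.
  have ml := margl_ge i j; have mr := margr_ge i j; have pij := p_ge0 i j.
  have [->|pn] := eqVneq (p i j) 0.
    rewrite !mul0r !subr0 !mulr_ge0 ?(ltW (f0 _ _))//; exact: sumr_ge0.
  have pp : 0 < p i j by rewrite lt_def pn.
  have lp : 0 < margl i by exact: lt_le_trans ml.
  have rp : 0 < margr j by exact: lt_le_trans mr.
  rewrite -mulrBr -ln_div ?posrE ?divr_gt0 ?mulr_gt0//.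
  rewrite invf_div mulrA [f i j * (_ * _)]mulrA.
  apply: mulr_ln_div_le; rewrite ?mulr_ge0 ?ltW//.
  by rewrite !mulf_neq0// gt_eqF.
under eq_bigr do rewrite sumrB.
rewrite sumrB psum exchange_big /= subr_le0.
apply: (@le_trans _ _ (\sum_j margr j)).
  apply: ler_sum => j _; rewrite -mulr_suml ler_piMl//; exact: sumr_ge0.
by rewrite /margr exchange_big /= psum.
Qed.

(** Since [p i j <= margl i], the information is at most the entropy of the second marginal, which
    is compared with the uniform weight [1 / K]. Only columns of nonzero mass are counted, because a
    partition may have many more cells than a finite-valued variable has values. *)
Lemma discrete_info_le_ln (K : nat) :
  (0 < K)%N ->
  (#|[pred j | margr j != 0%R]| <= K)%N ->
  \sum_i \sum_j p i j = 1 ->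
  discrete_info <= ln K%:R.
Proof.
move=> K0 JK psum.
have KR : (0 : R) < K%:R by rewrite ltr0n.
have mrsum : \sum_j margr j = 1 by rewrite /margr exchange_big.
have mr0 j : 0 <= margr j by exact: sumr_ge0.
have -> : ln (K%:R : R) = \sum_i \sum_j p i j * ln (K%:R : R).
  by under eq_bigr do rewrite -mulr_suml; rewrite -mulr_suml psum mul1r.
rewrite -subr_le0 /discrete_info -sumrB.
under eq_bigr do rewrite -sumrB.
rewrite exchange_big /=.
(* A column of zero mass contributes nothing; any other contributes at most
   [margr j * ln (K^-1 / margr j)], to which [mulr_ln_div_le] applies. *)
apply: (@le_trans _ _ (\sum_(j | margr j != 0) (K%:R^-1 - margr j))).
  rewrite [leRHS]big_mkcond /=; apply: ler_sum => j _.
  have [mj0|mjn] := eqVneq (margr j) 0.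
    rewrite big1// => i _.
    have -> : p i j = 0.
      by apply/eqP; rewrite eq_le p_ge0 andbT -mj0 margr_ge.
    by rewrite !mul0r subrr.
  have mjp : 0 < margr j by rewrite lt_def mjn mr0.
  apply: (@le_trans _ _ (\sum_i p i j * ln ((K%:R * margr j)^-1))).
    apply: ler_sum => i _.
    have [->|pn] := eqVneq (p i j) 0; first by rewrite !mul0r subrr.
    have pp : 0 < p i j by rewrite lt_def pn p_ge0.
    have lp : 0 < margl i by exact: lt_le_trans (margl_ge i j).
    rewrite -mulrBr ler_wpM2l// -ln_div ?posrE ?divr_gt0 ?mulr_gt0//.
    rewrite ler_ln ?posrE ?divr_gt0 ?invr_gt0 ?mulr_gt0//.
    rewrite [in leRHS]invfM [_^-1 * _]mulrC ler_pM2r ?invr_gt0//.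
    rewrite invfM mulrA ler_piMl ?invr_ge0// ler_pdivrMr// mul1r.
    exact: margl_ge.
  rewrite -mulr_suml -/(margr j).
  have := @mulr_ln_div_le R (margr j) K%:R^-1.
  rewrite invfM; apply => //.
  by rewrite invr_eq0 gt_eqF.
rewrite sumrB sumr_const -[_ *+ _]mulr_natr.
have -> : \sum_(j | margr j != 0) margr j = 1.
  rewrite -mrsum [RHS](bigID (fun j => margr j != 0)) /= [X in _ + X]big1 ?addr0//.
  by move=> j; rewrite negbK => /eqP.
by rewrite subr_le0 mulrC ler_pdivrMr// mul1r ler_nat.
Qed.

End discrete_information.

(** * Geometric sums, integral bounds and finite measurable partitions *)

Lemma sum_expr_le (R : realType) (q : R) (M : nat) :
  0 <= q < 1 -> \sum_(m < M) q ^+ m <= (1 - q)^-1.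
Proof.
move=> /andP[q0 q1].
have q1' : 0 < 1 - q by rewrite subr_gt0.
rewrite -[leRHS]mul1r ler_pdivlMr// mulrC.
have := subrXX 1 q M; rewrite expr1n.
under eq_bigr do rewrite expr1n mul1r.
by move=> <-; rewrite gerBl exprn_ge0.
Qed.

(** The integral of a nonnegative function is a supremum over the simple functions below it, hence
    monotone for arbitrary integrands. Path masses and distortions can then be bounded without a
    discussion of their measurability. *)
Lemma ge0_le_integral_nonmeas d (T : measurableType d) (R : realType)
    (mu : {measure set T -> \bar R}) (D : set T) (f g : T -> \bar R) :
  (forall x, D x -> 0 <= f x)%E -> (forall x, D x -> f x <= g x)%E ->
  (\int[mu]_(x in D) f x <= \int[mu]_(x in D) g x)%E.
Proof.
move=> f0 fg; rewrite !ge0_integralE//; last first.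
  by move=> x Dx; exact: le_trans (f0 _ Dx) (fg _ Dx).
apply: ereal_sup_le => _ [h hf <-]; exists h => // x.
by apply: le_trans (hf x) _; exact: lee_restrict.
Qed.

Lemma ge0_le_integral_cst d (T : measurableType d) (R : realType)
    (mu : {measure set T -> \bar R}) (D : set T) (f : T -> \bar R) (C : \bar R) :
  measurable D ->
  (forall x, D x -> 0 <= f x)%E -> (forall x, D x -> f x <= C)%E ->
  (\int[mu]_(x in D) f x <= C * mu D)%E.
Proof.
by move=> mD f0 fC; rewrite -integral_cst//; exact: ge0_le_integral_nonmeas.
Qed.

Lemma measure_partition d (T : measurableType d) (R : realType)
    (mu : {measure set T -> \bar R}) (I : finType) (F : I -> set T) (E : set T) :
  (forall i, measurable (F i)) -> trivIset setT F -> cover setT F = setT ->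
  measurable E -> mu E = (\sum_i mu (E `&` F i))%E.
Proof.
move=> mF tF cF mE.
have -> : (\sum_i mu (E `&` F i) = \sum_(i \in [set: I]) mu (E `&` F i))%E.
  rewrite fsbig_seq ?index_enum_uniq//; apply: eq_fsbigl.
  by apply/seteqP; split => // i _ /=; exact: mem_index_enum.
rewrite -measure_fin_bigcup; first by rewrite -setI_bigcupr -[bigcup _ _]/(cover setT F) cF setIT.
- exact: finite_finset.
- exact: trivIset_setIl.
- by move=> i _; exact: measurableI.
Qed.

Lemma measurable_fun_finite d1 d2 (T1 : measurableType d1)
    (T2 : measurableType d2) (I : finType) (u : T1 -> I) (g : I -> T2) :
  (forall i, measurable (u @^-1` [set i])) -> measurable_fun setT (g \o u).
Proof.
move=> mu _ B mB; rewrite setTI.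
have -> : (g \o u) @^-1` B = \bigcup_(i in g @^-1` B) u @^-1` [set i].
  apply/seteqP; split => [x Bx|x [i Bi /= ux]]; first by exists (u x).
  by rewrite /= ux.
by apply: fin_bigcup_measurable => //; exact: finite_finset.
Qed.

(** * Metric and Borel structure of the sequence space *)

Section metric_borel.
Context {R : realType} {X : compactMetricType R}.

Lemma measurable_cball (x : X) (r : R) : measurable (cball x r : set (borel X)).
Proof.
rewrite -[cball x r]setCK; apply: measurableC; apply: sub_sigma_algebra.
rewrite /= openE => y; rewrite /interior /cball /= => /negP; rewrite -ltNge => ry.
apply/nbhs_ballP; exists (mdist x y - r); first by rewrite /= subr_gt0.
move=> z; rewrite ballEmdist /= => yz; apply/negP; rewrite -ltNge.
have := metric_triangle x z y; rewrite [mdist z y]metric_sym; lra.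
Qed.

Lemma seqdist_ge_coord (x y : seqspace X) (n : nat) :
  mdist (x n) (y n) <= 2 ^+ n * mdist x y.
Proof.
rewrite -ler_pdivrMl// -[leRHS]/(seqdist x y).
have t0 k : 0 <= 2 ^- k * mdist (x k) (y k) by rewrite mulr_ge0 ?mdist_ge0.
have nd : nondecreasing_seq (series (fun n => 2 ^- n * mdist (x n) (y n) : R)).
  by apply: nondecreasing_series => k _.
apply: le_trans (nondecreasing_cvgn_le nd (@seqdist_cvg _ _ x y) n.+1).
by rewrite /series /= big_nat_recr //= lerDr sumr_ge0.
Qed.

(** The weights [2^-i] sum to at most 2 over the controlled coordinates and to [2 * 2^-m] over the
    remaining ones, where only the bound [M] is available. *)
Lemma seqdist_le (delta M : R) (m : nat) (x y : seqspace X) :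
  0 <= delta -> 0 <= M -> (forall a b : X, mdist a b <= M) ->
  (forall i, (i < m)%N -> mdist (x i) (y i) <= delta) ->
  mdist x y <= 2 * delta + 2 * M * 2 ^- m.
Proof.
move=> d0 M0 HM Hd.
(* Twice [tail n] is the sum of [2^-i] over [m <= i < n], so the partial sums can be bounded by
   induction on [n]. *)
pose tail n := if (n <= m)%N then 0 else 2 ^- m - 2 ^- n : R.
have e0 k : 0 < (2 ^- k : R) by rewrite invr_gt0 exprn_gt0.
apply: limr_le; first exact: seqdist_cvg.
apply: nearW => n.
apply: (@le_trans _ _ (2 * delta * (1 - 2 ^- n) + 2 * M * tail n)); last first.
  apply: lerD.
    by rewrite ler_piMr ?mulr_ge0// gerBl ltW.
  rewrite ler_wpM2l ?mulr_ge0// /tail; case: ifP => _; first exact: ltW.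
  by rewrite gerBl ltW.
elim: n => [|n IH].
  by rewrite /series /= big_nil /tail leq0n expr0 invr1 subrr !mulr0 addr0.
rewrite /series /= big_nat_recr //=.
apply: le_trans (lerD IH (lexx _)) _.
have eS : 2 ^- n = 2 * 2 ^- n.+1 :> R by rewrite exprS invfM mulrA divff ?mul1r.
have := e0 n.+1; rewrite /tail eS; set e := 2 ^- n.+1 => ep.
have [nm|mn] := ltnP n m.
  rewrite (ltnW nm) !mulr0 !addr0.
  have := ler_wpM2l (ltW ep) (Hd _ nm); lra.
case: ifP => [nm|_].
  have -> : m = n by apply/eqP; rewrite eqn_leq mn nm.
  rewrite eS -/e mulr0 addr0.
  have := ler_wpM2l (ltW ep) (HM (x n) (y n)); have := mulr_ge0 d0 (ltW ep); lra.
have := ler_wpM2l (ltW ep) (HM (x n) (y n)); have := mulr_ge0 d0 (ltW ep); lra.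
Qed.

(** By [seqdist_ge_coord] the coordinates are Lipschitz, so preimages of open sets are open. *)
Lemma measurable_coord (n : nat) :
  measurable_fun [set: borel (seqspace X)]
    ((fun x => x n) : borel (seqspace X) -> borel X).
Proof.
apply: (@measurability _ _ (borel (seqspace X)) (borel X) setT _ (@open X)) => //.
move=> _ [U oU <-]; rewrite setTI; apply: sub_sigma_algebra.
move: oU; rewrite /= !openE => oU x /= Ux.
have [e e0 eU] := (nbhs_ballP _ _).1 (oU _ Ux).
apply/nbhs_ballP; exists (e / 2 ^+ n); first by rewrite /= divr_gt0 ?exprn_gt0.
move=> y; rewrite ballEmdist /= ltr_pdivlMr ?exprn_gt0// mulrC => xy.
apply: eU; rewrite ballEmdist /=; exact: le_lt_trans (seqdist_ge_coord _ _ _) xy.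
Qed.

End metric_borel.

(** * Finite nets with measurable cells *)

Section finite_net.
Context {R : realType} {X : compactMetricType R}.
Variables (rho : probability (borel X) R) (delta kappa : R).
Hypothesis delta_gt0 : 0 < delta.
Hypothesis kappa_gt0 : 0 < kappa.
Hypothesis ball_ge : forall x : X, (kappa%:E <= rho (cball x (delta / 2)))%E.

Let separated n (f : 'I_n -> X) :=
  forall i j, i != j -> delta < mdist (f i) (f j).

(** The closed balls of radius [delta / 2] around the points are disjoint, because the separation is
    strict, and each has mass at least [kappa]. *)
Let separated_card n (f : 'I_n -> X) : separated f -> n%:R * kappa <= 1.
Proof.
move=> sf; rewrite -lee_fin.
pose B i := cball (f i) (delta / 2) : set (borel X).
have mB i : measurable (B i) by exact: measurable_cball.
have tB : trivIset setT B.
  move=> i j _ _ [z [zi zj]]; apply/eqP/negP => /negP/sf.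
  apply/negP; rewrite -leNgt; move: zi zj; rewrite /B /cball /=.
  have := metric_triangle (f i) z (f j); rewrite [mdist z (f j)]metric_sym; lra.
apply: (@le_trans _ _ (\sum_(i < n) rho (B i))%E); last first.
  rewrite -measure_bigsetU_ord//; apply: probability_le1.
  by apply: bigsetU_measurable => i _.
apply: (@le_trans _ _ (\sum_(i < n) kappa%:E)%E); last first.
  by apply: lee_sum => i _; exact: ball_ge.
by rewrite sumEFin sumr_const card_ord mulr_natl.
Qed.

(** The centres form a separated family of maximal cardinality, and [q x] is the least index of a
    centre within [delta] of [x]. Separation gives [q (ctr i) = i]; taking the least index makes
    each cell a ball minus finitely many earlier balls, hence Borel. *)
Lemma finite_net :
  exists (N : nat) (ctr : 'I_N -> X) (q : X -> 'I_N),
    [/\ N%:R * kappa <= 1,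
        forall i, q (ctr i) = i,
        forall x, mdist x (ctr (q x)) <= delta &
        forall i, measurable (q @^-1` [set i] : set (borel X))].
Proof.
pose P n := `[< exists f : 'I_n -> X, separated f >].
have exP : exists n, P n.
  by exists 0%N; apply/asboolP; exists (fun=> point) => -[].
have ubP n : P n -> (n <= Num.truncn kappa^-1)%N.
  move=> /asboolP[f /separated_card nk].
  by rewrite truncn_ge_nat ?invr_ge0 ?(ltW kappa_gt0)// -[leRHS]div1r ler_pdivlMr.
case: (ex_maxnP exP ubP) => N /asboolP[ctr sc] Nmax.
have cov x : exists i, mdist x (ctr i) <= delta.
  apply: contrapT => /forallNP nx.
  (* A point farther than [delta] from every centre could be added to the family, against
     maximality. *)
  suff : P N.+1 by move=> /Nmax; rewrite ltnn.
  apply/asboolP.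
  exists (fun i => if unlift ord0 i is Some j then ctr j else x) => i j.
  have far k : delta < mdist x (ctr k) by rewrite ltNge; apply/negP.
  case: unliftP => [i'|] ->; case: unliftP => [j'|] ->; rewrite ?eqxx//.
  - by rewrite (inj_eq lift_inj); exact: sc.
  - by move=> _; rewrite metric_sym.
pose q x := [arg min_(i < xchoose (cov x) | (mdist x (ctr i) <= delta)%R) i]%N.
have qP x : mdist x (ctr (q x)) <= delta /\
    forall j, mdist x (ctr j) <= delta -> (q x <= j)%N.
  by rewrite /q; case: (arg_minnP _ (xchooseP (cov x))).
exists N, ctr, q; split.
- exact: separated_card sc.
- move=> i; apply/eqP/negP => /negP; rewrite eq_sym => /sc.
  by rewrite ltNge (qP _).1.
- by move=> x; exact: (qP x).1.
move=> i.
have -> : q @^-1` [set i] = cball (ctr i) delta `&`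
    \bigcap_(j in [set j : 'I_N | (j < i)%N]) ~` cball (ctr j) delta.
  apply/seteqP; split => x /=.
    have [qx qmin] := qP x.
    move=> <-; split; first by rewrite /cball /= metric_sym.
    move=> j /= ji; rewrite /cball /= metric_sym => /qmin; by rewrite leqNgt ji.
  rewrite /cball /= => -[xi xj]; apply/val_inj/eqP; rewrite eqn_leq.
  have [qx qmin] := qP x.
  rewrite qmin 1?metric_sym//= leqNgt; apply/negP => /xj; apply.
  by rewrite /cball /= metric_sym.
apply: measurableI; first exact: measurable_cball.
apply: fin_bigcap_measurable; first exact: finite_finset.
by move=> j _; apply: measurableC; exact: measurable_cball.
Qed.

End finite_net.

(** * Mutual information and its finite discretizations *)

Lemma probability_partition d (T : measurableType d) (R : realType)
    (P : probability T R) (I : finType) (F : I -> set T) (E : set T) :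
  (forall i, measurable (F i)) -> trivIset setT F -> cover setT F = setT ->
  measurable E -> fine (P E) = \sum_i fine (P (E `&` F i)).
Proof.
move=> mF tF cF mE; apply: EFin_inj.
rewrite EFin_sum_fine; last first.
  by move=> i _; apply: fin_num_measure; exact: measurableI.
by rewrite fineK ?fin_num_measure//; exact: measure_partition.
Qed.

Section mutual_info_bounds.
Context {R : realType} {d1 d2 d : measure_display} {T1 : measurableType d1}
  {T2 : measurableType d2} {Omega : measurableType d}.
Variables (P : probability Omega R) (X : {RV P >-> T1}) (Z : {RV P >-> T2}).

Definition joint_mass (I J : Type) (A : I -> set T1) (B : J -> set T2) i j : R :=
  fine (P (X @^-1` A i `&` Z @^-1` B j)).

Lemma joint_mass_ge0 (I J : Type) (A : I -> set T1) (B : J -> set T2) i j :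
  0 <= joint_mass A B i j.
Proof. by apply: fine_ge0; exact: measure_ge0. Qed.

Let mpre d' (T : measurableType d') (Y : {RV P >-> T}) (A : set T) :
  measurable A -> measurable (Y @^-1` A).
Proof. by move=> mA; rewrite -[_ @^-1` _]setTI; exact: measurable_funP. Qed.

Section marginals.
Context (I J : finType) (A : I -> set T1) (B : J -> set T2).
Hypotheses (mA : forall i, measurable (A i)) (mB : forall j, measurable (B j)).
Hypotheses (tA : trivIset setT A) (cA : cover setT A = setT).
Hypotheses (tB : trivIset setT B) (cB : cover setT B = setT).

Lemma joint_mass_suml i : \sum_j joint_mass A B i j = fine (P (X @^-1` A i)).
Proof.
rewrite (@probability_partition _ _ _ P _ (fun j => Z @^-1` B j))//.
- by move=> j; exact: mpre.
- by move=> j k _ _ [w [wj wk]]; apply: tB => //; exists (Z w).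
- apply/seteqP; split => // w _.
  have : cover setT B (Z w) by rewrite cB.
  by move=> [j _ Bj]; exists j.
- exact: mpre.
Qed.

Lemma joint_mass_sumr j : \sum_i joint_mass A B i j = fine (P (Z @^-1` B j)).
Proof.
rewrite (@probability_partition _ _ _ P _ (fun i => X @^-1` A i))//.
- by apply: eq_bigr => i _; rewrite /joint_mass setIC.
- by move=> i; exact: mpre.
- by move=> i k _ _ [w [wi wk]]; apply: tA => //; exists (X w).
- apply/seteqP; split => // w _.
  have : cover setT A (X w) by rewrite cA.
  by move=> [i _ Ai]; exists i.
- exact: mpre.
Qed.

Lemma joint_mass_sum : \sum_i \sum_j joint_mass A B i j = 1.
Proof.
under eq_bigr do rewrite joint_mass_suml.
have := @probability_partition _ _ _ P _ (fun i => X @^-1` A i) setT.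
rewrite probability_setT /= => ->.
- by apply: eq_bigr => i _; rewrite setTI.
- by move=> i; exact: mpre.
- by move=> i k _ _ [w [wi wk]]; apply: tA => //; exists (X w).
- apply/seteqP; split => // w _.
  have : cover setT A (X w) by rewrite cA.
  by move=> [i _ Ai]; exists i.
- exact: measurableT.
Qed.

Lemma discrete_info_joint_mass :
  discrete_info (joint_mass A B) =
  \sum_i \sum_j joint_mass A B i j *
    ln (joint_mass A B i j / (fine (P (X @^-1` A i)) * fine (P (Z @^-1` B j)))).
Proof.
apply: eq_bigr => i _; apply: eq_bigr => j _.
by rewrite -joint_mass_suml -joint_mass_sumr.
Qed.

End marginals.

Lemma fibers_partition (T : Type) (I : finType) (u : T -> I) :
  trivIset setT (fun i => u @^-1` [set i]) /\
  cover setT (fun i => u @^-1` [set i]) = setT.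
Proof.
split; first by move=> i j _ _ [x [/= <- <-]].
by apply/seteqP; split => // x _; exists (u x).
Qed.

(** The fibers of [u] and [v] form one of the pairs of partitions in the supremum. Surjectivity is
    required because the cells of a [partition] are nonempty; [enum_val] reindexes them by
    ordinals. *)
Lemma discrete_info_le_mutual_info (I J : finType) (u : T1 -> I) (v : T2 -> J) :
  (forall i, exists x, u x = i) -> (forall j, exists y, v y = j) ->
  (forall i, measurable (u @^-1` [set i])) ->
  (forall j, measurable (v @^-1` [set j])) ->
  ((discrete_info (joint_mass (fun i => u @^-1` [set i])
                              (fun j => v @^-1` [set j])))%:E
    <= mutual_info X Z)%E.
Proof.
move=> su sv mu mv; apply: ereal_sup_ubound.
exists #|I|, #|J|, (fun i => u @^-1` [set enum_val i]),
  (fun j => v @^-1` [set enum_val j]); split.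
- split=> //; split.
  + apply/seteqP; split => // x _; exists (enum_rank (u x)) => //=.
    by rewrite enum_rankK.
  + by move=> i j _ _ [x [/= -> /enum_val_inj]].
  + by move=> i _; have [x xi] := su (enum_val i); exists x.
- split=> //; split.
  + apply/seteqP; split => // x _; exists (enum_rank (v x)) => //=.
    by rewrite enum_rankK.
  + by move=> i j _ _ [x [/= -> /enum_val_inj]].
  + by move=> i _; have [x xi] := sv (enum_val i); exists x.
have [tu cu] := fibers_partition u; have [tv cv] := fibers_partition v.
rewrite discrete_info_joint_mass//; congr EFin.
rewrite big_enum_val /=; apply: eq_bigr => i _.
by rewrite big_enum_val.
Qed.

(** However fine the partition of the target of [Z], at most [#|J|] of its cells carry mass, so
    [discrete_info_le_ln] bounds every term of the supremum. *)
Lemma mutual_info_le_ln_card (J : finType) (g : J -> T2) (u : Omega -> J) :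
  (forall w, Z w = g (u w)) -> (mutual_info X Z <= (ln #|J|%:R)%:E)%E.
Proof.
move=> Zgu; apply: ge_ereal_sup => _ [m [n [A [B [[[cA tA _] mA]
  [[cB tB _] mB] ->]]]]].
rewrite lee_fin -discrete_info_joint_mass//.
apply: discrete_info_le_ln.
- by move=> i j; exact: joint_mass_ge0.
- by apply/card_gt0P; exists (u point).
(* [h] picks for each cell of nonzero mass a value of [g] inside it; disjointness of the cells makes
   [h] injective on them. *)
- have /choice[h hP] j : exists y : J,
      fine (P (Z @^-1` B j)) != 0 -> B j (g y).
    have [[y yB]|nB] := pselect (exists y, B j (g y)); first by exists y.
    exists (u point); rewrite (_ : Z @^-1` B j = set0) ?measure0 ?eqxx//.
    by apply/seteqP; split => // w /=; rewrite Zgu => Bw; apply: nB; exists (u w).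
  rewrite -(@card_in_image _ _ h); first exact: max_card.
  move=> i j; rewrite !inE !joint_mass_sumr// => /hP Bi /hP Bj ij.
  by apply: tB => //; exists (g (h i)); split=> //; rewrite ij.
- exact: joint_mass_sum.
Qed.

End mutual_info_bounds.

(** * Upper bound: block coding of orbits *)

Lemma iter_left_shift (T : Type) (k i : nat) (x : seqspace T) :
  iter k (@left_shift T) x i = x (k + i)%N.
Proof. by elim: k i => // k IH i; rewrite /= /left_shift IH addSnnS. Qed.

Section coding.
Context {R : realType} {X : compactMetricType R}.
Variables (N : nat) (ctr : 'I_N -> X) (q : X -> 'I_N).
Hypothesis mq : forall i, measurable (q @^-1` [set i] : set (borel X)).

Definition code n (x : seqspace X) : {ffun 'I_n -> 'I_N} :=
  [ffun i : 'I_n => q (x i)].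

Lemma code_fiber n (a : {ffun 'I_n -> 'I_N}) :
  code n @^-1` [set a] = [set x | forall i : 'I_n, q (x i) = a i].
Proof.
apply/seteqP; split => x /=; first by move=> <- i; rewrite ffunE.
by move=> xa; apply/ffunP => i; rewrite ffunE.
Qed.

Lemma measurable_code_fiber n (a : {ffun 'I_n -> 'I_N}) :
  measurable (code n @^-1` [set a] : set (borel (seqspace X))).
Proof.
have -> : code n @^-1` [set a] =
    \bigcap_(i in [set: 'I_n])
      (fun x : seqspace X => x (nat_of_ord i)) @^-1` (q @^-1` [set a i]).
  rewrite code_fiber.
  by apply/seteqP; split => x /= xa i; [move=> _|]; exact: xa.
apply: fin_bigcap_measurable; first exact: finite_finset.
move=> i _; rewrite -[_ @^-1` _]setTI.
exact: (@measurable_coord R X i).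
Qed.

Variables (mu : probability (borel (seqspace X)) R).

(** The source is the identity on the space of [mu], and the reproduction is a function of the code
    of its first [n + m] coordinates, so it has at most [N ^ (n + m)] values. *)
Lemma rate_distortion_le (delta M eps : R) (m n : nat) :
  (0 < n)%N -> 0 <= delta -> 0 <= M -> (forall a b : X, mdist a b <= M) ->
  (forall x, mdist x (ctr (q x)) <= delta) ->
  2 * delta + 2 * M * 2 ^- m < eps ->
  (rate_distortion (@left_shift X) mu eps <=
    (n%:R^-1 * (ln N%:R *+ (n + m)))%:E)%E.
Proof.
move=> n0 d0 M0 HM Hq dme.
(* The [k]-th reproduced point reads the code from position [k] on. For every [k < n] its first [m]
   coordinates are centres, as [seqdist_le] requires; past the end of the code it is filled with the
   base point. *)
pose g (a : {ffun 'I_(n + m) -> 'I_N}) : n.-tuple (borel (seqspace X)) :=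
  [tuple (fun i => if insub (k + i)%N is Some j then ctr (a j) else point)
    | k < n].
pose f := g \o code (n + m).
have mf : measurable_fun [set: borel (seqspace X)] f.
  exact: (measurable_fun_finite _ (@measurable_code_fiber _)).
pose Z : {RV mu >-> n.-tuple (borel (seqspace X))} :=
  HB.pack f (isMeasurableFun.Build _ _ _ _ _ mf).
pose id_ : borel (seqspace X) -> borel (seqspace X) := fun x => x.
have mid : measurable_fun setT id_ by exact: measurable_id.
pose W : {RV mu >-> borel (seqspace X)} :=
  HB.pack id_ (isMeasurableFun.Build _ _ _ _ _ mid).
have N0 : (0 < N)%N by case: N (q point) => // -[].
apply: ge_ereal_inf; exists ((n%:R^-1)%:E * mutual_info W Z)%E.
  exists n, _, _, mu, W, Z; split => //.
  rewrite unlock; apply: le_lt_trans (_ : (2 * delta + 2 * M * 2 ^- m)%:E < _)%E;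
    last by rewrite lte_fin.
  (* The distortion bound holds pointwise, hence in mean over a probability. *)
  rewrite -[leRHS]mule1 -(@probability_setT _ _ _ mu).
  apply: ge0_le_integral_cst => // x _; rewrite lee_fin /mean_distortion.
    by rewrite mulr_ge0 ?invr_ge0// sumr_ge0// => i _; exact: mdist_ge0.
  rewrite ler_pdivrMl ?ltr0n//.
  rewrite [leRHS](_ : _ = \sum_(k < n) (2 * delta + 2 * M * 2 ^- m)); last first.
    by rewrite sumr_const card_ord -[RHS]mulr_natl.
  apply: ler_sum => k _; rewrite tnth_mktuple.
  apply: seqdist_le => // i im; rewrite iter_left_shift.
  have kim : (k + i < n + m)%N by rewrite -addnS leq_add// ltnW.
  by rewrite insubT /= ffunE; exact: Hq.
rewrite EFinM lee_wpmul2l ?lee_fin ?invr_ge0//.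
have := @mutual_info_le_ln_card _ _ _ _ _ _ _ mu W Z _ g (code (n + m)) (fun=> erefl).
by rewrite card_ffun !card_ord natrX lnXn ?ltr0n.
Qed.

End coding.

(** * Cylinder masses of the Gibbs measure *)

Section gibbs_cylinders.
Context {R : realType} {X : compactMetricType R}.
Variables (rho : probability (borel X) R).

Lemma path_mass_ge0 (K : X -> X -> R) n (A : nat -> set X) (x : X) :
  (forall x y, 0 <= K x y) -> (0 <= path_mass rho K n A x)%E.
Proof.
move=> K0; elim: n A x => [|n IH] A x /=; first exact: lee01.
by apply: integral_ge0 => y _; rewrite mule_ge0// lee_fin.
Qed.

(** Each of the [n] nested integrations costs one factor [C] and one mass [rho (A i)]. *)
Lemma path_mass_le (K : X -> X -> R) (C : R) n (A : nat -> set X) (x : X) :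
  (forall x y, 0 <= K x y) -> (forall x y, K x y <= C) ->
  (forall i, measurable (A i : set (borel X))) ->
  (path_mass rho K n A x <= (C ^+ n * \prod_(i < n) fine (rho (A i)))%:E)%E.
Proof.
move=> K0 KC; elim: n A x => [|n IH] A x mA /=.
  by rewrite expr0 big_ord0 mulr1.
apply: (@le_trans _ _ ((C * (C ^+ n * \prod_(i < n) fine (rho (A i.+1))))%:E
    * rho (A 0%N))%E).
  apply: ge0_le_integral_cst; first exact: mA.
    by move=> y _; rewrite mule_ge0 ?lee_fin ?path_mass_ge0.
  move=> y _; rewrite EFinM; apply: lee_pmul => //.
  - by rewrite lee_fin.
  - exact: path_mass_ge0.
  - by rewrite lee_fin.
  - by apply: (IH (fun i => A i.+1)) => i; exact: mA.
have fA : rho (A 0%N) = (fine (rho (A 0%N)))%:E.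
  by rewrite fineK//; apply: fin_num_measure; exact: mA.
rewrite [in leLHS]fA -EFinM lee_fin big_ord_recl exprS -!mulrA.
by rewrite [_ * fine _]mulrC.
Qed.

Lemma continuous_bounded_above (f : X -> R) :
  continuous f -> exists M : R, forall x, f x <= M.
Proof.
move=> cf.
have [||c _ cM] := @compact_EVT_max X R f setT _ compact_setT.
- by exists point.
- exact: continuous_subspaceT.
by exists (f c) => x; exact: cM (mem_set _).
Qed.

Lemma continuous_pos_bounded_below (f : X -> R) :
  continuous f -> (forall x, 0 < f x) -> exists2 m : R, 0 < m & forall x, m <= f x.
Proof.
move=> cf f0.
have [||c _ cM] := @compact_EVT_min X R f setT _ compact_setT.
- by exists point.
- exact: continuous_subspaceT.
by exists (f c) => // x; exact: cM (mem_set _).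
Qed.

Lemma holder_bounded_above (phi : seqspace X -> R) :
  holder phi -> exists M : R, forall x, phi x <= M.
Proof.
move=> [a [C [/andP[a0 _] H]]]; have [M M0 HM] := @mdist_bounded R X.
pose y : seqspace X := fun=> point.
exists (phi y + `|C| * (2 * M) `^ a) => x.
rewrite -lerBlDl; apply: le_trans (ler_norm _) _.
apply: le_trans (H x y) _; apply: le_trans (ler_norm _) _; rewrite normrM.
rewrite ler_wpM2l// ger0_norm ?powR_ge0// ge0_ler_powR ?nnegrE ?(ltW a0)//.
- exact: mdist_ge0.
- exact: mulr_ge0.
(* With no controlled coordinate ([m = 0]) this bounds the diameter of the sequence space by
   [2 * M]. *)
- have := @seqdist_le _ X 0 M 0 x y (lexx _) M0 HM.
  by rewrite mulr0 add0r expr0 invr1 mulr1; apply.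
Qed.

Variables (phi : seqspace X -> R) (mu : probability (borel (seqspace X)) R).

(** By compactness [psi] and [psib] are bounded above and [psib] is bounded away from 0; as [phi] is
    bounded above too, the density and the kernel have uniform upper bounds [Ct] and [CK]. *)
Lemma gibbs_cylinder_le :
  holder phi -> gibbs_measure rho phi mu ->
  exists2 C : R, 0 < C & forall n (A : nat -> set X),
    (forall i, measurable (A i : set (borel X))) ->
    (mu [set x : seqspace X | forall i, (i <= n)%N -> A i (x i)] <=
      (C ^+ n.+1 * \prod_(i < n.+1) fine (rho (A i)))%:E)%E.
Proof.
move=> /holder_bounded_above[Mphi Hphi].
move=> [l [psi [psib [[l0 _] [[cpsi _ _] [cpsib _ _]] pos _ Hmu]]]].
have [Mp HMp] := continuous_bounded_above cpsi.
have [Mb HMb] := continuous_bounded_above cpsib.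
have [mb mb0 Hmb] := continuous_pos_bounded_below cpsib (fun x => (pos x).2).
have Mp0 : 0 <= Mp by apply: le_trans (HMp point); have [/ltW] := pos point.
have Mb0 : 0 <= Mb by apply: le_trans (HMb point); have [_ /ltW] := pos point.
(* Nonnegativity of [I] suffices for the bounds below, as the inverse of 0 is 0. *)
pose I := \int[rho]_y (psi y * psib y).
have I0 : 0 <= I.
  apply: fine_ge0; apply: integral_ge0 => y _; rewrite lee_fin.
  by have [/ltW ? /ltW ?] := pos y; exact: mulr_ge0.
pose CK := expR Mphi * Mb / (mb * l); pose Ct := Mp * Mb / I.
pose K := gibbs_kernel phi l psib.
have K0 x y : 0 <= K x y.
  rewrite /K /gibbs_kernel divr_ge0 ?mulr_ge0 ?expR_ge0 ?(ltW l0)//.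
    by have [_ /ltW] := pos y.
  by have [_ /ltW] := pos x.
have KC x y : K x y <= CK.
  rewrite /K /gibbs_kernel /CK; apply: ler_pM.
  - by rewrite mulr_ge0 ?expR_ge0//; have [_ /ltW] := pos y.
  - by rewrite invr_ge0 mulr_ge0 ?(ltW l0)//; have [_ /ltW] := pos x.
  - apply: ler_pM => //; first by have [_ /ltW] := pos y.
    by rewrite ler_expR; exact: Hphi.
  - rewrite lef_pV2 ?posrE ?mulr_gt0//; last by have [] := pos x.
    by rewrite ler_pM2r.
have t0 x : 0 <= gibbs_density rho psi psib x.
  have [/ltW ? /ltW ?] := pos x.
  by rewrite /gibbs_density divr_ge0// mulr_ge0.
have tC x : gibbs_density rho psi psib x <= Ct.
  have [/ltW ? /ltW ?] := pos x.
  by rewrite /gibbs_density /Ct ler_wpM2r ?invr_ge0// ler_pM.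
have CK0 : 0 <= CK by exact: le_trans (KC point point).
have Ct0 : 0 <= Ct by exact: le_trans (tC point).
(* One constant dominates both the density and the kernel; the summand 1 makes it positive. *)
exists (Ct + CK + 1); first by rewrite ltr_pwDr// addr_ge0.
move=> n A mA; rewrite Hmu//.
set C := Ct + CK + 1.
have C0 : 0 <= C by rewrite !addr_ge0.
apply: (@le_trans _ _ ((C * (C ^+ n * \prod_(i < n) fine (rho (A i.+1))))%:E
    * rho (A 0%N))%E).
  apply: ge0_le_integral_cst; first exact: mA.
    by move=> x _; rewrite mule_ge0 ?lee_fin// path_mass_ge0.
  move=> x _; rewrite [leRHS]EFinM; apply: lee_pmul => //.
  - by rewrite lee_fin.
  - exact: path_mass_ge0.
  - rewrite lee_fin; apply: le_trans (tC x) _; rewrite /C; lra.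
  - apply: (@path_mass_le K C n (fun i => A i.+1)) => // y z.
    apply: le_trans (KC y z) _; rewrite /C; lra.
have fA : rho (A 0%N) = (fine (rho (A 0%N)))%:E.
  by rewrite fineK//; apply: fin_num_measure; exact: mA.
rewrite [in leLHS]fA -EFinM lee_fin big_ord_recl exprS -!mulrA.
by rewrite [_ * fine _]mulrC.
Qed.

End gibbs_cylinders.

(** * Integrals of the exponential kernel at scale [eps] *)

Lemma powR_le_expR (R : realType) (s t : R) : 0 < s -> 0 < t ->
  t `^ s <= (2 * s) `^ s * expR (t / 2).
Proof.
move=> s0 t0; have s20 : 0 < 2 * s by rewrite mulr_gt0.
(* The claim is [ln u <= u] at [u = t / (2 * s)], multiplied by [s] and exponentiated. The factor 2
   keeps half of the decay of [exp(-t)] for the later summation. *)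
have u0 : 0 < t / (2 * s) by rewrite divr_gt0.
have -> : t `^ s = (2 * s) `^ s * (t / (2 * s)) `^ s.
  by rewrite -powRM ?ltW// mulrC divfK// gt_eqF.
rewrite ler_wpM2l ?powR_ge0//.
rewrite -[leLHS]lnK ?posrE ?powR_gt0// ln_powR ler_expR.
have -> : t / 2 = s * (t / (2 * s)).
  by field; rewrite gt_eqF.
by rewrite ler_wpM2l ?ltW// ln_sublinear.
Qed.

Section exponential_kernel.
Context {R : realType} {X : compactMetricType R}.
Variables (rho : probability (borel X) R) (c s : R).
Hypothesis s_gt0 : 0 < s.
Hypothesis c_ge0 : 0 <= c.
Hypothesis ball_le : forall (x : X) (r : R), 0 < r ->
  fine (rho (cball x r)) <= c * r `^ s.

(* The integral of exp(-d(x,z)/eps) is split over the shells m eps < d <= (m+1) eps;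
   powR_le_expR bounds (m+2)^s e^-m by (2s)^s e e^(-m/2), a geometric series. *)
Definition exp_kernel_const : R :=
  (c + 1) * ((2 * s) `^ s * expR 1) * (1 - expR (- 2^-1))^-1.

Lemma exp_kernel_const_gt0 : 0 < exp_kernel_const.
Proof.
rewrite /exp_kernel_const mulr_gt0 ?invr_gt0 ?subr_gt0 ?expR_lt1 ?oppr_lt0//.
by rewrite mulr_gt0 ?ltr_wpDl// mulr_gt0 ?powR_gt0 ?expR_gt0// mulr_gt0.
Qed.

Variables (eps : R) (N : nat) (ctr : 'I_N -> X) (q : X -> 'I_N).
Hypothesis eps_gt0 : 0 < eps.
Hypothesis mq : forall i, measurable (q @^-1` [set i] : set (borel X)).
Hypothesis q_near : forall x, mdist x (ctr (q x)) <= eps.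

Lemma sum_exp_kernel_le (z : X) :
  \sum_a fine (rho (q @^-1` [set a])) * expR (- (mdist (ctr a) z / eps)) <=
  exp_kernel_const * eps `^ s.
Proof.
have [M M0 HM] := @mdist_bounded R X.
pose K := (Num.truncn (M / eps)).+1.
pose F a : set (borel X) := q @^-1` [set a].
have F0 a : 0 <= fine (rho (F a)) by exact: fine_ge0.
pose t a := mdist (ctr a) z / eps.
have t0 a : 0 <= t a by rewrite divr_ge0 ?mdist_ge0// ltW.
have tK a : (Num.truncn (t a) < K)%N.
  by rewrite ltnS; apply: le_truncn; rewrite ler_pM2r ?invr_gt0.
(* The single term [m = truncn (t a)] already dominates the left side. Shells are thus replaced by
   balls [t a <= m + 1], at the price of nonnegative extra terms. *)
have step a : expR (- t a) <=
    \sum_(m < K) (t a <= m.+1%:R)%R%:R * expR (- m%:R).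
  rewrite (bigD1 (Ordinal (tK a)))//=.
  have -> : t a <= (Num.truncn (t a)).+1%:R by rewrite ltW// truncnS_gt.
  rewrite mulr1n mul1r.
  rewrite ler_wpDr//; last by rewrite ler_expR lerN2 truncn_le.
  by apply: sumr_ge0 => m _; rewrite mulr_ge0 ?expR_ge0.
apply: (@le_trans _ _ (\sum_(m < K) expR (- m%:R) *
    \sum_a fine (rho (F a)) * (t a <= m.+1%:R)%R%:R)).
  under [leRHS]eq_bigr do rewrite mulr_sumr.
  rewrite exchange_big /=; apply: ler_sum => a _.
  apply: le_trans (ler_wpM2l (F0 a) (step a)) _.
  rewrite mulr_sumr le_eqVlt; apply/orP; left; apply/eqP.
  by apply: eq_bigr => m _; ring.
have inner m : \sum_a fine (rho (F a)) * (t a <= m.+1%:R)%R%:R <=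
    (c + 1) * ((m.+2)%:R * eps) `^ s.
  (* A cell whose centre is within [(m + 1) * eps] of [z] lies in this ball, since its points are
     within [eps] of the centre. *)
  pose E := cball z (m.+2%:R * eps) : set (borel X).
  have mE : measurable E by exact: measurable_cball.
  have r0 : 0 < m.+2%:R * eps by rewrite mulr_gt0.
  apply: (@le_trans _ _ (fine (rho E))); last first.
    apply: le_trans (ball_le _ r0) _.
    by rewrite ler_wpM2r ?powR_ge0// lerDl.
  have [tF cF] := fibers_partition q.
  rewrite (@probability_partition _ _ _ rho _ F E)//.
  apply: ler_sum => a _; case: (leP (t a)) => ta; last first.
    by rewrite mulr0 fine_ge0.
  rewrite mulr1 (_ : E `&` F a = F a)//; apply/setIidr => x /= qx.
  rewrite /E /cball /=; have := metric_triangle z (ctr a) x.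
  have := q_near x; rewrite qx [mdist x _]metric_sym [mdist z (ctr a)]metric_sym.
  move: ta; rewrite /t ler_pdivrMr// -[in m.+2]addn1 -[in m.+1]addn1 !natrD.
  lra.
apply: (@le_trans _ _ (\sum_(m < K) (c + 1) * ((2 * s) `^ s * expR 1) *
    eps `^ s * expR (- 2^-1) ^+ m)).
  apply: ler_sum => m _; apply: le_trans (ler_wpM2l (expR_ge0 _) (inner m)) _.
  rewrite (powRM _ (ler0n _ _) (ltW eps_gt0)).
  have := @powR_le_expR R s m.+2%:R s_gt0 (ltr0Sn _ _).
  have -> : expR (m.+2%:R / 2) = expR 1 * expR (2^-1 * m%:R) :> R.
    rewrite -expRD; congr expR; by rewrite -[in m.+2]addn2 natrD; field.
  have -> : expR (- 2^-1) ^+ m = expR (- m%:R) * expR (2^-1 * m%:R) :> R.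
    by rewrite -expRM_natl -expRD; congr expR; field.
  move=> H; have e0 := powR_ge0 eps s.
  have := ler_wpM2r e0 (ler_wpM2l (expR_ge0 (- m%:R)) H).
  move=> /(ler_wpM2l (addr_ge0 c_ge0 ler01)).
  by congr (_ <= _); ring.
rewrite -mulr_sumr /exp_kernel_const [leRHS]mulrAC ler_wpM2l//.
  by rewrite !mulr_ge0 ?addr_ge0 ?powR_ge0 ?expR_ge0.
by apply: sum_expr_le; rewrite expR_ge0 expR_lt1 oppr_lt0 invr_gt0 ltr0n.
Qed.

End exponential_kernel.

(** * Lower bound on the rate distortion function *)

Lemma sum_fibers_le_integral d (T : measurableType d) (R : realType)
    (P : probability T R) (K : finType) (t : T -> K) (c : K -> R) (h : T -> \bar R) :
  (forall k, measurable (t @^-1` [set k])) ->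
  (forall k, 0 <= c k) -> (forall w, (c (t w))%:E <= h w)%E ->
  ((\sum_k c k * fine (P (t @^-1` [set k])))%:E <= \int[P]_w h w)%E.
Proof.
move=> mt c0 ch.
pose F k w : R := c k * \1_(t @^-1` [set k]) w.
have Fsum w : \sum_k F k w = c (t w).
  rewrite (bigD1 (t w))//= big1 ?addr0 => [|k kt].
    by rewrite /F indicE mem_set// mulr1.
  rewrite /F indicE memNset ?mulr0// => /= tk.
  by rewrite tk eqxx in kt.
(* The left side is the integral of the simple function [c \o t], which lies below [h]. *)
apply: (@le_trans _ _ (\int[P]_w (\sum_k (F k w)%:E))%E); last first.
  apply: ge0_le_integral_nonmeas => w _; rewrite sumEFin Fsum ?lee_fin//.
rewrite ge0_integral_sum//; last 2 first.
- move=> k; apply/measurable_EFinP; exact: measurable_funM.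
- by move=> k w _; rewrite lee_fin mulr_ge0.
rewrite -sumEFin; apply: lee_sum => k _.
rewrite /F; under eq_integral do rewrite EFinM.
rewrite ge0_integralZl_EFin//; last first.
  by apply/measurable_EFinP; exact: measurable_indic.
rewrite integral_indic// setIT EFinM fineK//.
exact: fin_num_measure.
Qed.

Section lower_bound.
Context {R : realType} {X : compactMetricType R}.
Variables (rho : probability (borel X) R) (mu : probability (borel (seqspace X)) R).
Variables (C D eps : R) (N : nat) (ctr : 'I_N -> X) (q : X -> 'I_N).
Hypotheses (C_gt0 : 0 < C) (D_gt0 : 0 < D) (eps_gt0 : 0 < eps).
Hypothesis cylinder_le : forall n (A : nat -> set X),
  (forall i, measurable (A i : set (borel X))) ->
  (mu [set x : seqspace X | forall i, (i <= n)%N -> A i (x i)] <=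
    (C ^+ n.+1 * \prod_(i < n.+1) fine (rho (A i)))%:E)%E.
Hypothesis q_ctr : forall i, q (ctr i) = i.
Hypothesis mq : forall i, measurable (q @^-1` [set i] : set (borel X)).
Hypothesis q_near : forall x, mdist x (ctr (q x)) <= eps.
Hypothesis kernel_le : forall z : X,
  \sum_a fine (rho (q @^-1` [set a])) * expR (- (mdist (ctr a) z / eps)) <= D.

Let code_mass_le n (a : {ffun 'I_n.+1 -> 'I_N}) :
  fine (mu (code q n.+1 @^-1` [set a])) <=
  \prod_k (C * fine (rho (q @^-1` [set a k]))).
Proof.
(* [cylinder_le] takes a sequence of sets; only the indices up to [n] matter, and the others get the
   whole space. *)
pose A i := if insub i is Some k then q @^-1` [set a k] else setT.
have Aord (k : 'I_n.+1) : A k = q @^-1` [set a k] by rewrite /A valK.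
have mA i : measurable (A i : set (borel X)).
  by rewrite /A; case: insub => [k|]; [exact: mq|exact: measurableT].
have := cylinder_le n mA.
have -> : [set x : seqspace X | forall i, (i <= n)%N -> A i (x i)] =
    code q n.+1 @^-1` [set a].
  rewrite code_fiber; apply/seteqP; split => x /= H i.
    by have := H i; rewrite -ltnS ltn_ord Aord; apply.
  rewrite -ltnS => ilt; have := H (Ordinal ilt).
  by rewrite -[i]/(val (Ordinal ilt)) Aord.
rewrite big_split /= prodr_const card_ord.
under eq_bigr do rewrite Aord.
rewrite -[X in (X <= _)%E]fineK ?lee_fin// fin_num_measure//.
exact: measurable_code_fiber.
Qed.

(** Only the zeroth coordinate of each reproduced point is encoded: its weight in the metric is 1,
    so the distance of zeroth coordinates is at most the distance of the sequences. *)
Let tcode n (z : n.-tuple (seqspace X)) : {ffun 'I_n -> 'I_N} :=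
  [ffun k : 'I_n => q (tnth z k 0%N)].

Let measurable_tcode_fiber n (b : {ffun 'I_n -> 'I_N}) :
  measurable (@tcode n @^-1` [set b] : set (n.-tuple (borel (seqspace X)))).
Proof.
have -> : @tcode n @^-1` [set b] = \bigcap_(k in [set: 'I_n])
    (fun z : n.-tuple (seqspace X) => tnth z k 0%N) @^-1` (q @^-1` [set b k]).
  apply/seteqP; split => z /=; first by move=> <- k _ /=; rewrite ffunE.
  by move=> zb; apply/ffunP => k; rewrite ffunE; exact: zb.
apply: fin_bigcap_measurable; first exact: finite_finset.
move=> k _; rewrite -[_ @^-1` _]setTI.
have : measurable_fun [set: n.-tuple (borel (seqspace X))]
    ((fun x : borel (seqspace X) => (x 0%N : borel X)) \o (fun z => tnth z k)).
  by apply: measurableT_comp; [exact: measurable_coord|exact: measurable_tnth].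
exact.
Qed.

(** Both variables are discretized, which can only lower the information, and [discrete_info_ge] is
    applied. In the constant 3, measured in units of [eps], the mean distortion accounts for 1 and
    the move of both points to their centres for 2. *)
Lemma rate_distortion_ge :
  ((- 3 - ln (C * D))%:E <= rate_distortion (@left_shift X) mu eps)%E.
Proof.
apply: le_ereal_inf_tmp => _ [n [d [T [P [W [Z [n0 WP EP ->]]]]]]].
case: n n0 Z EP => // n _ Z EP.
have nR : 0 < n.+1%:R :> R by rewrite ltr0n.
rewrite lee_pdivlMl// -EFinM.
pose A (i : {ffun 'I_n.+1 -> 'I_N}) : set (borel (seqspace X)) :=
  code q n.+1 @^-1` [set i].
pose B (j : {ffun 'I_n.+1 -> 'I_N}) : set (n.+1.-tuple (borel (seqspace X))) :=
  @tcode n.+1 @^-1` [set j].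
apply: le_trans (_ : (discrete_info (joint_mass W Z A B))%:E <= _)%E; last first.
  apply: discrete_info_le_mutual_info.
  - move=> i; exists (fun k => if insub k is Some k' then ctr (i k') else point).
    by apply/ffunP => k; rewrite ffunE valK q_ctr.
  - move=> j; exists [tuple (fun=> ctr (j k)) | k < n.+1].
    by apply/ffunP => k; rewrite ffunE tnth_mktuple q_ctr.
  - exact: measurable_code_fiber.
  - exact: measurable_tcode_fiber.
pose CD := ln (C * D).
have CD0 : 0 < C * D by exact: mulr_gt0.
pose dist (i j : {ffun 'I_n.+1 -> 'I_N}) : R :=
  \sum_k mdist (ctr (i k)) (ctr (j k)).
pose p := joint_mass W Z A B.
have p0 i j : 0 <= p i j by exact: joint_mass_ge0.
have mA i : measurable (A i) by exact: measurable_code_fiber.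
have mB j : measurable (B j) by exact: measurable_tcode_fiber.
have [tA cA] := fibers_partition (code q n.+1 : borel (seqspace X) -> _).
have [tB cB] := fibers_partition (@tcode n.+1).
have psum : \sum_i \sum_j p i j = 1 by exact: joint_mass_sum.
(* The test kernel: up to normalization, exp(-(sum of the distances)/eps). *)
pose f i j := expR (- (dist i j / eps) - n.+1%:R * CD).
have fE i j : f i j =
    \prod_k (expR (- (mdist (ctr (i k)) (ctr (j k)) / eps)) / (C * D)).
  rewrite /f expRD big_split /= -expR_sum; congr (_ * _).
    by rewrite /dist mulr_suml -sumrN.
  by rewrite prodr_const card_ord expRN expRM_natl /CD lnK// exprVn.
have fsum j : \sum_i f i j * (\sum_j' p i j') <= 1.
  (* The cylinder bound contributes [C] per coordinate, which cancels the [C] in [f]. The sum over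
     codes of a product then factors into a product of single-letter sums, each at most 1 by
     [kernel_le]. *)
  apply: (@le_trans _ _ (\sum_(i : {ffun 'I_n.+1 -> 'I_N}) \prod_k
      (fine (rho (q @^-1` [set i k])) *
       expR (- (mdist (ctr (i k)) (ctr (j k)) / eps)) / D))).
    apply: ler_sum => i _.
    have -> : \sum_j' p i j' = fine (mu (A i)).
      by rewrite joint_mass_suml// -WP.
    apply: (@le_trans _ _ (f i j * \prod_k (C * fine (rho (q @^-1` [set i k]))))).
      by rewrite ler_wpM2l ?expR_ge0//; exact: code_mass_le.
    rewrite fE -big_split /= le_eqVlt; apply/orP; left; apply/eqP.
    by apply: eq_bigr => k _; field; rewrite !gt_eqF.
  rewrite -(bigA_distr_bigA (fun (k : 'I_n.+1) (a : 'I_N) =>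
    fine (rho (q @^-1` [set a])) *
       expR (- (mdist (ctr a) (ctr (j k)) / eps)) / D)).
  apply: prodr_ile1 => k _; rewrite -mulr_suml; apply/andP; split.
    rewrite divr_ge0 ?(ltW D_gt0)// sumr_ge0// => a _.
    by rewrite mulr_ge0 ?expR_ge0// fine_ge0.
  by rewrite ler_pdivrMr// mul1r.
apply: le_trans (discrete_info_ge p0 (fun i j => expR_gt0 _) fsum psum).
have -> : \sum_i \sum_j p i j * ln (f i j) =
    - ((\sum_i \sum_j p i j * dist i j) / eps) - n.+1%:R * CD.
  under eq_bigr do under eq_bigr do rewrite /f expRK mulrBr mulrN mulrA.
  under eq_bigr do rewrite sumrB sumrN -!mulr_suml.
  by rewrite sumrB sumrN -!mulr_suml psum mul1r.
rewrite mulrBr lerD2r mulrN lerN2 ler_pdivrMr//.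
(* The discretized distortion minus the error [2 * eps] of moving to centres is below the true
   distortion; the maximum with 0 supplies the nonnegativity asked by [sum_fibers_le_integral]. *)
pose c (ij : {ffun 'I_n.+1 -> 'I_N} * {ffun 'I_n.+1 -> 'I_N}) : R :=
  Num.max 0 (n.+1%:R^-1 * dist ij.1 ij.2 - 2 * eps).
pose t w := (code q n.+1 (W w), tcode (Z w)).
have tE i j : t @^-1` [set (i, j)] = W @^-1` A i `&` Z @^-1` B j.
  by apply/seteqP; split => w /=; [case=> <- <-|case=> <- <-].
have mt k : measurable (t @^-1` [set k]).
  case: k => i j; rewrite tE; apply: measurableI.
    by rewrite -[_ @^-1` _]setTI; exact: (measurable_funP W).
  by rewrite -[_ @^-1` _]setTI; exact: (measurable_funP Z).
have c0 k : 0 <= c k by rewrite le_max lexx.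
have ch w : ((c (t w))%:E <=
    (mean_distortion (@left_shift X) (W w) (Z w))%:E)%E.
  rewrite lee_fin /mean_distortion ge_max; apply/andP; split.
    by rewrite mulr_ge0 ?invr_ge0// sumr_ge0// => i _; exact: mdist_ge0.
  rewrite lerBlDr -(ler_pM2l nR) mulrDr !mulrA divff ?gt_eqF// !mul1r.
  have -> : n.+1%:R * 2 * eps = \sum_(k < n.+1) (2 * eps).
    by rewrite sumr_const card_ord -[RHS]mulr_natl mulrA.
  rewrite -big_split; apply: ler_sum => k _ /=.
  rewrite !ffunE; set x := W w k; set y := tnth (Z w) k 0%N.
  have xy : mdist x y <= mdist (iter k (@left_shift X) (W w)) (tnth (Z w) k).
    have := seqdist_ge_coord (iter k (@left_shift X) (W w)) (tnth (Z w) k) 0.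
    by rewrite iter_left_shift addn0 expr0 mul1r.
  have := metric_triangle (ctr (q x)) x (ctr (q y)).
  have := metric_triangle x y (ctr (q y)).
  have := q_near x; have := q_near y; rewrite [mdist x (ctr _)]metric_sym.
  lra.
have := le_lt_trans (sum_fibers_le_integral P mt c0 ch).
move: EP; rewrite unlock => EP /(_ _ EP); rewrite lte_fin.
rewrite (eq_bigr (fun k => c (k.1, k.2) * p k.1 k.2)); last first.
  by move=> [i j] _; rewrite tE.
rewrite -(pair_bigA _ (fun i j => c (i, j) * p i j)) /= => /ltW cp.
rewrite -mulrA -ler_pdivrMl// mulr_sumr.
apply: (@le_trans _ _ (\sum_i \sum_j (c (i, j) * p i j + 2 * eps * p i j))).
  apply: ler_sum => i _; rewrite mulr_sumr; apply: ler_sum => j _.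
  rewrite -mulrDl mulrCA [leLHS]mulrC ler_wpM2r//.
  rewrite -lerBlDr /c /=. by rewrite le_max lexx orbT.
under eq_bigr do rewrite big_split /= -mulr_sumr.
rewrite big_split /= -mulr_sumr psum; lra.
Qed.

End lower_bound.

(** * Upper and lower limits from logarithmic growth *)

Lemma limf_esup_near (R : realType) (F : set_system R)
    (f : R -> \bar R) (l : R) : ProperFilter F ->
  (forall e : R, 0 < e ->
    \forall x \near F, ((l - e)%:E <= f x <= (l + e)%:E)%E) ->
  limf_esup f F = l%:E.
Proof.
move=> FF H; rewrite limf_esupE; apply/eqP; rewrite eq_le; apply/andP; split.
  apply/lee_addgt0Pr => e e0; apply: ge_ereal_inf.
  exists (ereal_sup (f @` [set x | ((l - e)%:E <= f x <= (l + e)%:E)%E])).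
    by exists [set x | ((l - e)%:E <= f x <= (l + e)%:E)%E]; [exact: H|].
  by apply: ge_ereal_sup => _ [x /andP[_ fx] <-].
apply: le_ereal_inf_tmp => _ [V FV <-].
apply/lee_addgt0Pr => e e0.
(* As the filter is proper, every set of it meets the one where [f] is at least [l - e]. *)
have [x [Vx /andP[fx _]]] := filter_ex (filterI FV (H e e0)).
rewrite -[l](subrK e) EFinD leeD2r//.
by apply: le_trans fx _; apply: ereal_sup_ubound; exists x.
Qed.

Lemma limf_esup_einf_near (R : realType) (F : set_system R)
    (f : R -> \bar R) (l : R) : ProperFilter F ->
  (forall e : R, 0 < e ->
    \forall x \near F, ((l - e)%:E <= f x <= (l + e)%:E)%E) ->
  limf_esup f F = l%:E /\ limf_einf f F = l%:E.
Proof.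
move=> FF H; split; first exact: limf_esup_near.
rewrite /limf_einf (@limf_esup_near _ _ _ (- l))//; first by rewrite -EFinN opprK.
move=> e /H; apply: filterS => x /andP[fl fu].
have -> : - l - e = - (l + e) by rewrite opprD.
have -> : - l + e = - (l - e) by rewrite opprB addrC.
by rewrite !EFinN !leeN2; apply/andP.
Qed.

Lemma log_growth_limits (R : realType) (f : R -> \bar R) (s K e0 : R) :
  0 < e0 ->
  (forall eps, 0 < eps < e0 ->
    ((s * `|ln eps| - K)%:E <= f eps <= (s * `|ln eps| + K)%:E)%E) ->
  limf_esup (fun eps : R => (f eps * (`|ln eps|^-1)%:E)%E) 0^'+ = s%:E /\
  limf_einf (fun eps : R => (f eps * (`|ln eps|^-1)%:E)%E) 0^'+ = s%:E.
Proof.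
move=> e00 H; apply: limf_esup_einf_near => e ep.
near=> eps.
have eps0 : 0 < eps by near: eps; exact: nbhs_right_gt.
have epse : eps < e0 by near: eps; exact: nbhs_right_lt.
(* Below this threshold [|ln eps| > |K| / e + 1], so [|K| <= e * |ln eps|]; the summand 1 keeps
   [|ln eps|] positive even when [K = 0]. *)
have epsK : eps < expR (- (`|K| / e + 1)).
  by near: eps; apply: nbhs_right_lt; exact: expR_gt0.
have lnKe : `|K| / e + 1 < `|ln eps|.
  rewrite [`|ln eps|]ltr0_norm; last first.
    rewrite -expR_lt1 lnK ?posrE//; apply: (lt_trans epsK).
  by rewrite ltrNr -ltr_expR lnK ?posrE.
set L := `|ln eps| in lnKe *.
have Ke0 : 0 <= `|K| / e by rewrite divr_ge0// ltW.
have L0 : 0 < L by apply: lt_trans lnKe; rewrite ltr_wpDl.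
have KL : `|K| <= e * L.
  rewrite mulrC -ler_pdivrMr//; apply: ltW; apply: lt_trans lnKe; lra.
have := H eps; rewrite eps0 epse -/L => /(_ isT) /andP[lo hi].
have KN := ler_norm K.
apply/andP; split.
  rewrite lee_pdivlMr// -EFinM; apply: le_trans lo; rewrite lee_fin.
  by rewrite mulrBl; lra.
rewrite lee_pdivrMr// -EFinM; apply: le_trans hi _; rewrite lee_fin.
by rewrite mulrDl; lra.
Unshelve. all: by end_near. Qed.

(** * Bounds for Ahlfors regular measures *)

Section ahlfors.
Context {R : realType} {X : compactMetricType R}.

Lemma mdist_le_diam (x y : X) : mdist x y <= diam X.
Proof.
have [M _ HM] := @mdist_bounded R X.
apply: ub_le_sup; last by exists (x, y).
by exists M => _ [p _ <-]; exact: HM.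
Qed.

Variables (rho : probability (borel X) R) (s c : R).
Hypotheses (s_gt0 : 0 < s) (c_ge1 : 1 <= c) (diam_gt0 : 0 < diam X).
Hypothesis regular : forall (x : X) (r : R), 0 < r <= diam X ->
  ((c^-1 * r `^ s)%:E <= rho (cball x r) <= (c * r `^ s)%:E)%E.

Let c_gt0 : 0 < c. Proof. exact: lt_le_trans c_ge1. Qed.

(** Beyond the diameter the ball is the whole space, of mass [1 <= c * diam X ^ s], and the right
    side increases with [r]. *)
Lemma ahlfors_ball_le (x : X) (r : R) : 0 < r ->
  fine (rho (cball x r)) <= c * r `^ s.
Proof.
move=> r0; rewrite -lee_fin fineK; last first.
  by apply: fin_num_measure; exact: measurable_cball.
have [rd|dr] := leP r (diam X).
  have rI : 0 < r <= diam X by rewrite r0.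
  by have /andP[] := regular x rI.
apply: le_trans (probability_le1 _ _) _; first exact: measurable_cball.
have dI : 0 < diam X <= diam X by rewrite diam_gt0 lexx.
have /andP[_] := regular x dI; rewrite (_ : cball x (diam X) = setT) ?probability_setT; last first.
  by apply/seteqP; split => // y _; exact: mdist_le_diam.
move=> /le_trans; apply; rewrite lee_fin ler_wpM2l ?(ltW c_gt0)//.
by rewrite ge0_ler_powR ?nnegrE ?(ltW s_gt0) ?(ltW diam_gt0) ?(ltW r0) ?(ltW dr).
Qed.

Lemma ahlfors_net (delta : R) : 0 < delta -> delta / 2 <= diam X ->
  exists (N : nat) (ctr : 'I_N -> X) (q : X -> 'I_N),
    [/\ N%:R * (c^-1 * (delta / 2) `^ s) <= 1,
        forall i, q (ctr i) = i,
        forall x, mdist x (ctr (q x)) <= delta &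
        forall i, measurable (q @^-1` [set i] : set (borel X))].
Proof.
move=> d0 dd; have d20 : 0 < delta / 2 by rewrite divr_gt0.
apply: (@finite_net R X rho) => //.
  by rewrite mulr_gt0 ?invr_gt0// powR_gt0.
have dI : 0 < delta / 2 <= diam X by rewrite d20.
by move=> x; have /andP[] := regular x dI.
Qed.

Variable mu : probability (borel (seqspace X)) R.

Lemma rate_distortion_upper (eps : R) : 0 < eps <= diam X ->
  (rate_distortion (@left_shift X) mu eps <=
    (- (s * ln eps) + (ln c + s * ln 16 + 1))%:E)%E.
Proof.
move=> /andP[eps0 epsd].
(* At scale [eps / 8] the coded coordinates cost [eps / 4]; with at most [eps / 2] for the tail, the
   total stays strictly below [eps]. The half-radius [eps / 16] is the source of [ln 16]. *)
have [|| N [ctr [q [NK qc qd mq]]]] := @ahlfors_net (eps / 8).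
- by rewrite divr_gt0.
- lra.
have N0 : (0 < N)%N by exact: leq_ltn_trans (leq0n _) (ltn_ord (q point)).
have [M M0 HM] := @mdist_bounded R X.
(* This gives [4 * M / eps < m < 2^m]. *)
pose m := (Num.truncn (4 * M / eps)).+1.
have mM : 2 * M * 2 ^- m <= eps / 2.
  rewrite ler_pdivrMr ?exprn_gt0//.
  have : 4 * M / eps < (2 ^ m)%:R.
    by apply: lt_trans (truncnS_gt _) _; rewrite ltr_nat ltn_expl.
  rewrite ltr_pdivrMr// natrX; lra.
have lnN : ln N%:R <= - (s * ln eps) + (ln c + s * ln 16).
  have e16 : 0 < eps / 8 / 2 by rewrite !divr_gt0.
  have NR : 0 < N%:R :> R by rewrite ltr0n.
  have K0 : 0 < c^-1 * (eps / 8 / 2) `^ s by rewrite mulr_gt0 ?invr_gt0// powR_gt0.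
  have : ln (N%:R * (c^-1 * (eps / 8 / 2) `^ s)) <= 0.
    exact: ln_le0.
  rewrite !lnM ?posrE ?invr_gt0 ?powR_gt0// lnV ?posrE// ln_powR.
  have -> : eps / 8 / 2 = eps / 16 by field.
  rewrite ln_div ?posrE//; lra.
have lnN0 : 0 <= ln N%:R :> R by apply: ln_ge0; rewrite ler1n.
(* With [n >= m * ln N], the [m] extra coordinates add at most 1 to the rate. *)
pose n := (Num.truncn (ln N%:R *+ m : R)).+1.
have n0 : 0 < n%:R :> R by rewrite ltr0n.
have nm : ln N%:R *+ m <= n%:R :> R by rewrite ltW// truncnS_gt.
apply: (@le_trans _ _ (n%:R^-1 * (ln N%:R *+ (n + m)))%:E).
  apply: (@rate_distortion_le _ _ _ ctr q mq mu (eps / 8) M) => //.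
  - by rewrite divr_ge0// ltW.
  - lra.
rewrite lee_fin ler_pdivrMl// mulrnDr -[ln _ *+ n]mulr_natl.
have := ler_wpM2l (ltW n0) lnN; lra.
Qed.

(** The net and the kernel share the scale [eps]; the factor [eps^s] in the kernel bound becomes the
    leading term [- s * ln eps]. *)
Lemma rate_distortion_lower (C : R) : 0 < C ->
  (forall n (A : nat -> set X),
    (forall i, measurable (A i : set (borel X))) ->
    (mu [set x : seqspace X | forall i, (i <= n)%N -> A i (x i)] <=
      (C ^+ n.+1 * \prod_(i < n.+1) fine (rho (A i)))%:E)%E) ->
  forall eps, 0 < eps <= diam X ->
  ((- (s * ln eps) - (3 + ln (C * exp_kernel_const c s)))%:E <=
    rate_distortion (@left_shift X) mu eps)%E.
Proof.
move=> C0 HC eps /andP[eps0 epsd].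
have [//|| N [ctr [q [NK qc qd mq]]]] := @ahlfors_net eps; first lra.
have E0 := exp_kernel_const_gt0 s_gt0 (ltW c_gt0).
have D0 : 0 < exp_kernel_const c s * eps `^ s by rewrite mulr_gt0// powR_gt0.
have := @rate_distortion_ge _ _ rho mu C _ eps N ctr q C0 D0 eps0 HC qc mq qd.
move=> H; apply: le_trans (H _); last first.
  move=> z; exact: (sum_exp_kernel_le s_gt0 (ltW c_gt0) ahlfors_ball_le).
have -> : ln (C * (exp_kernel_const c s * eps `^ s)) =
    ln (C * exp_kernel_const c s) + s * ln eps.
  by rewrite mulrA [LHS]lnM ?posrE ?powR_gt0// ?ln_powR//; exact: mulr_gt0.
by rewrite lee_fin; lra.
Qed.

End ahlfors.

Theorem theorem1 (R : realType) (X : compactMetricType R) (s : R)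
    (rho : probability (borel X) R) (phi : seqspace X -> R)
    (mu : probability (borel (seqspace X)) R) :
  0 < s ->
  (exists x y : X, x <> y) ->
  ahlfors_regular s rho ->
  holder phi ->
  depends_on_two phi ->
  gibbs_measure rho phi mu ->
  upper_rdim (@left_shift X) mu = s%:E /\ lower_rdim (@left_shift X) mu = s%:E.
Proof.
move=> s0 [x [y xy]] [c c1 reg] hphi _ gmu.
have d0 : 0 < diam X.
  by apply: lt_le_trans (mdist_le_diam x y); rewrite mdist_gt0; exact/eqP.
have [C C0 HC] := gibbs_cylinder_le hphi gmu.
pose K1 := ln c + s * ln 16 + 1; pose K2 := 3 + ln (C * exp_kernel_const c s).
(* Below 1 the logarithm is negative, and below the diameter regularity applies. The error term
   covers both one-sided constants. *)
apply: (@log_growth_limits R _ s (`|K1| + `|K2|) (Num.min 1 (diam X))).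
  by rewrite lt_min ltr01 d0.
move=> eps /andP[eps0]; rewrite lt_min => /andP[eps1 epsd].
have -> : `|ln eps| = - ln eps.
  by rewrite ltr0_norm// ln_lt0// eps0.
have epsI : 0 < eps <= diam X by rewrite eps0 ltW.
apply/andP; split.
  apply: le_trans _ (rate_distortion_lower s0 c1 d0 reg C0 HC epsI).
  by rewrite lee_fin -/K2; have := ler_norm K2; have := normr_ge0 K1; lra.
apply: le_trans (rate_distortion_upper c1 reg mu epsI) _.
by rewrite lee_fin -/K1; have := ler_norm K1; have := normr_ge0 K2; lra.
Qed.
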